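(* Let $G(\lambda)\in\mathbb F(\lambda)^{p\times m}$ and let $L(\lambda)$ be a strong block minimal bases linearization of $G(\lambda)$ as in the context. (a) If $\varepsilon_1\le\dots\le\varepsilon_l$ are the right minimal indices of $G(\lambda)$, then $\varepsilon_1+\deg N_1(\lambda)\le\dots\le\varepsilon_l+\deg N_1(\lambda)$ are the right minimal indices of $L(\lambda)$. (b) If $\eta_1\le\dots\le\eta_q$ are the left minimal indices of $G(\lambda)$, then $\eta_1+\deg N_2(\lambda)\le\dots\le\eta_q+\deg N_2(\lambda)$ are the left minimal indices of $L(\lambda)$.
   Context: $\mathbb F$ is an arbitrary field. A polynomial matrix $K\in\mathbb F[\lambda]^{a\times b}$, $a<b$, is a minimal basis if its rows form a minimal basis (polynomial basis of least total degree) of the subspace they span; $K\in\mathbb F[\lambda]^{a_1\times b}$, $N\in\mathbb F[\lambda]^{a_2\times b}$ are dual minimal bases if both are minimal bases, $a_1+a_2=b$ and $KN^T=0$. Strong block minimal bases linearization: write $G=D+C(\lambda I_n-A)^{-1}B$ with $D$ the polynomial part, $\deg D>1$, and $C(\lambda I_n-A)^{-1}B$ a minimal order state-space realization of the strictly proper part. Let $K_1\in\mathbb F[\lambda]^{\widehat m\times(m+\widehat m)}$, $K_2\in\mathbb F[\lambda]^{\widehat p\times(p+\widehat p)}$ be minimal bases with all row degrees $1$, $N_1\in\mathbb F[\lambda]^{m\times(m+\widehat m)}$, $N_2\in\mathbb F[\lambda]^{p\times(p+\widehat p)}$ minimal bases dual to $K_1,K_2$, each with all row degrees equal, and $M(\lambda)$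 a $(p+\widehat p)\times(m+\widehat m)$ pencil with $D=N_2MN_1^T$ and $\deg D=\deg N_1+\deg N_2+1$. Let constant $\widehat K_i$ and polynomial $\widehat N_i$ be such that $\begin{bmatrix}K_i\\ \widehat K_i\end{bmatrix}$ is unimodular with inverse $\begin{bmatrix}\widehat N_i^T & N_i^T\end{bmatrix}$, $i=1,2$. For nonsingular $T,S$, $L(\lambda)=\begin{bmatrix}T(\lambda I_n-A)S & TB\widehat K_1 & 0\\ -\widehat K_2^TCS & M(\lambda) & K_2(\lambda)^T\\ 0 & K_1(\lambda) & 0\end{bmatrix}$. Right (left) minimal indices of a rational matrix $G$: degrees of the vectors of a minimal basis (polynomial basis of least total degree) of $\mathcal N_r(G)=\{x:Gx=0\}$ ($\mathcal N_\ell(G)=\{x:x^TG=0\}$). *)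

(* Defs.v *)
From HB Require Import structures.
From mathcomp Require Import all_boot all_order all_algebra.
From mathcomp Require Import fraction.
Set Implicit Arguments. Unset Strict Implicit. Unset Printing Implicit Defensive.
Import Order.TTheory GRing.Theory.
Local Open Scope ring_scope.

Definition ratF (F : fieldType) := {fraction {poly F}}.

Definition pfrac (F : fieldType) (q : {poly F}) : ratF F := @FracField.tofrac _ q.

Definition rmx (F : fieldType) (a b : nat) (K : 'M[{poly F}]_(a, b)) : 'M[ratF F]_(a, b) :=
  map_mx (@pfrac F) K.

Definition cmx (F : fieldType) (a b : nat) (K : 'M[F]_(a, b)) : 'M[{poly F}]_(a, b) :=
  map_mx polyC K.

(* degree of a polynomial (deg 0 := 0) *)
Definition pdeg (F : fieldType) (q : {poly F}) : nat := (size q).-1.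

Definition rowdeg (F : fieldType) (a b : nat) (K : 'M[{poly F}]_(a, b)) (i : 'I_a) : nat :=
  (\max_(j < b) pdeg (K i j))%N.

Definition mxdeg (F : fieldType) (a b : nat) (K : 'M[{poly F}]_(a, b)) : nat :=
  (\max_(i < a) rowdeg K i)%N.

Definition totdeg (F : fieldType) (a b : nat) (K : 'M[{poly F}]_(a, b)) : nat :=
  (\sum_(i < a) rowdeg K i)%N.

Definition poly_basis_of (F : fieldType) (b : nat) (V : 'rV[ratF F]_b -> Prop)
    (a : nat) (K : 'M[{poly F}]_(a, b)) : Prop :=
  row_free (rmx K) /\ (forall u : 'rV[ratF F]_b, V u <-> (u <= rmx K)%MS).

Definition min_basis_of (F : fieldType) (b : nat) (V : 'rV[ratF F]_b -> Prop)
    (a : nat) (K : 'M[{poly F}]_(a, b)) : Prop :=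
  poly_basis_of V K /\
  (forall (a' : nat) (K' : 'M[{poly F}]_(a', b)), poly_basis_of V K' ->
      (totdeg K <= totdeg K')%N).

Definition minimal_basis (F : fieldType) (a b : nat) (K : 'M[{poly F}]_(a, b)) : Prop :=
  (a < b)%N /\ min_basis_of (fun u => (u <= rmx K)%MS) K.

Definition dual_minimal_bases (F : fieldType) (a1 a2 b : nat)
    (K : 'M[{poly F}]_(a1, b)) (N : 'M[{poly F}]_(a2, b)) : Prop :=
  [/\ minimal_basis K, minimal_basis N, (a1 + a2)%N = b & K *m N^T = 0].

Definition right_null (F : fieldType) (p m : nat) (G : 'M[ratF F]_(p, m))
  (u : 'rV[ratF F]_m) : Prop := G *m u^T = 0.

Definition left_null (F : fieldType) (p m : nat) (G : 'M[ratF F]_(p, m))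
  (u : 'rV[ratF F]_p) : Prop := u *m G = 0.

Definition min_indices_of (F : fieldType) (b : nat) (V : 'rV[ratF F]_b -> Prop)
    (s : seq nat) : Prop :=
  exists (a : nat) (K : 'M[{poly F}]_(a, b)),
    min_basis_of V K /\ perm_eq s [seq rowdeg K i | i <- enum 'I_a].

Definition right_min_indices (F : fieldType) (p m : nat) (G : 'M[ratF F]_(p, m))
  (s : seq nat) : Prop := min_indices_of (right_null G) s.

Definition left_min_indices (F : fieldType) (p m : nat) (G : 'M[ratF F]_(p, m))
  (s : seq nat) : Prop := min_indices_of (left_null G) s.

Definition lam (F : fieldType) : ratF F := pfrac 'X.

Definition transfer (F : fieldType) (n p m : nat)
    (A : 'M[F]_n) (B : 'M[F]_(n, m)) (C : 'M[F]_(p, n)) : 'M[ratF F]_(p, m) :=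
  rmx (cmx C) *m invmx ((lam F)%:M - rmx (cmx A)) *m rmx (cmx B).

Definition minimal_realization (F : fieldType) (n p m : nat)
    (A : 'M[F]_n) (B : 'M[F]_(n, m)) (C : 'M[F]_(p, n)) : Prop :=
  forall (n' : nat) (A' : 'M[F]_n') (B' : 'M[F]_(n', m)) (C' : 'M[F]_(p, n')),
    transfer A' B' C' = transfer A B C -> (n <= n')%N.

Definition lampencil (F : fieldType) (n : nat) (A : 'M[F]_n) : 'M[{poly F}]_n :=
  'X%:M - cmx A.

Definition sbmb_lin (F : fieldType) (n p m hp hm : nat)
    (A : 'M[F]_n) (B : 'M[F]_(n, m)) (C : 'M[F]_(p, n))
    (T S : 'M[F]_n) (hK1 : 'M[F]_(m, m + hm)) (hK2 : 'M[F]_(p, p + hp))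
    (M : 'M[{poly F}]_(p + hp, m + hm)) (K1 : 'M[{poly F}]_(hm, m + hm))
    (K2 : 'M[{poly F}]_(hp, p + hp))
  : 'M[{poly F}]_(n + (p + hp + hm), n + (m + hm + hp)) :=
  block_mx (cmx T *m lampencil A *m cmx S) (row_mx (cmx (T *m B *m hK1)) 0)
           (col_mx (- cmx (hK2^T *m C *m S)) 0) (block_mx M K2^T K1 0).

(* Main.v *)
(** The right null space of [L] is the image of that of [G] under the injective
    map [h |-> (- S^-1 (lambda I - A)^-1 B h, N1^T h, - hN2 M N1^T h)], whose
    left inverse [(x, y, z) |-> hK1 y] is constant.  Observability of the minimal
    realization makes the first component polynomial when [h] is.  A basis of
    least total degree is row reduced, so degrees add up in products with [N1],
    [K2] and [lambda I - A^T]: the middle component has degree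
    [deg h + deg N1] and dominates the other two.  Hence polynomial bases of the
    two null spaces correspond, each row degree being shifted by [deg N1], and
    least total degrees correspond too.  The left indices follow because [L^T]
    is the pencil of [G^T] for the realization [(A^T, - C^T, - B^T)]. *)

Require Import Defs.
From HB Require Import structures.
From mathcomp Require Import all_boot all_order all_algebra.
From mathcomp Require Import fraction.
Set Implicit Arguments. Unset Strict Implicit. Unset Printing Implicit Defensive.
Import Order.TTheory GRing.Theory.
Local Open Scope ring_scope.

(** * Polynomial and constant matrices inside rational matrices *)

HB.instance Definition _ (F : fieldType) :=
  GRing.RMorphism.copy (@pfrac F) (@FracField.tofrac _).

Section RationalEmbedding.
Variable F : fieldType.

Lemma pfrac_inj : injective (@pfrac F).
Proof. by move=> p q /eqP; rewrite /pfrac tofrac_eq => /eqP. Qed.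

Lemma rmx_inj a b : injective (@rmx F a b).
Proof.
move=> U V /matrixP UV; apply/matrixP => i j.
by have := UV i j; rewrite !mxE => /pfrac_inj.
Qed.

Lemma rmxM a b c (U : 'M[{poly F}]_(a, b)) (V : 'M_(b, c)) :
  rmx (U *m V) = rmx U *m rmx V.
Proof. exact: map_mxM. Qed.

Lemma rmxD a b (U V : 'M[{poly F}]_(a, b)) : rmx (U + V) = rmx U + rmx V.
Proof. exact: map_mxD. Qed.

Lemma rmxN a b (U : 'M[{poly F}]_(a, b)) : rmx (- U) = - rmx U.
Proof. exact: map_mxN. Qed.

Lemma rmx0 a b : rmx (0 : 'M[{poly F}]_(a, b)) = 0.
Proof. exact: map_mx0. Qed.

Lemma rmx1 a : rmx (1%:M : 'M[{poly F}]_a) = 1%:M.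
Proof. exact: map_mx1. Qed.

Lemma rmx_tr a b (U : 'M[{poly F}]_(a, b)) : rmx U^T = (rmx U)^T.
Proof. by rewrite /rmx /cmx map_trmx. Qed.

Lemma rmx_row_mx a b c (U : 'M[{poly F}]_(a, b)) (V : 'M_(a, c)) :
  rmx (row_mx U V) = row_mx (rmx U) (rmx V).
Proof. exact: map_row_mx. Qed.

Lemma rmx_col_mx a b c (U : 'M[{poly F}]_(a, c)) (V : 'M_(b, c)) :
  rmx (col_mx U V) = col_mx (rmx U) (rmx V).
Proof. exact: map_col_mx. Qed.

Lemma rmx_unit a (U : 'M[{poly F}]_a) : \det U != 0 -> rmx U \in unitmx.
Proof.
move=> dU; rewrite unitmxE unitfE /rmx det_map_mx.
by apply: contraNneq dU => e; apply/eqP/pfrac_inj; rewrite rmorph0.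
Qed.

Lemma cmxM a b c (U : 'M[F]_(a, b)) (V : 'M_(b, c)) :
  cmx (U *m V) = cmx U *m cmx V.
Proof. exact: map_mxM. Qed.

Lemma cmxD a b (U V : 'M[F]_(a, b)) : cmx (U + V) = cmx U + cmx V.
Proof. exact: map_mxD. Qed.

Lemma cmxN a b (U : 'M[F]_(a, b)) : cmx (- U) = - cmx U.
Proof. exact: map_mxN. Qed.

Lemma cmx1 a : cmx (1%:M : 'M[F]_a) = 1%:M.
Proof. exact: map_mx1. Qed.

Lemma cmx_tr a b (U : 'M[F]_(a, b)) : cmx U^T = (cmx U)^T.
Proof. by rewrite /rmx /cmx map_trmx. Qed.

(** The determinant is the characteristic polynomial of [A], which is monic and hence nonzero. *)
Lemma lampencil_unit n (A : 'M[F]_n) : rmx (lampencil A) \in unitmx.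
Proof. exact: rmx_unit (monic_neq0 (char_poly_monic A)). Qed.

Lemma lampencil_tr n (A : 'M[F]_n) : lampencil A^T = (lampencil A)^T.
Proof. by rewrite /lampencil cmx_tr raddfB /= tr_scalar_mx. Qed.

Lemma rmx_lampencil n (A : 'M[F]_n) :
  rmx (lampencil A) = (lam F)%:M - rmx (cmx A).
Proof. by rewrite /rmx /lampencil map_mxB map_scalar_mx. Qed.

End RationalEmbedding.

(** * Row degrees and row reduced polynomial matrices *)

Section RowDegree.
Variable F : fieldType.

Lemma size_rowdeg a b (K : 'M[{poly F}]_(a, b)) i j :
  (size (K i j) <= (rowdeg K i).+1)%N.
Proof.
apply: leq_trans (leqSpred _) _; rewrite ltnS.
exact: (leq_bigmax (F := fun j => pdeg (K i j))).
Qed.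

Lemma rowdeg_leP a b (K : 'M[{poly F}]_(a, b)) i d :
  reflect (forall j, (size (K i j) <= d.+1)%N) (rowdeg K i <= d)%N.
Proof.
apply: (iffP idP) => [le_d j | le_d].
  exact: leq_trans (size_rowdeg K i j) _.
by apply/bigmax_leqP => j _; rewrite /pdeg -subn1 leq_subLR add1n.
Qed.

Lemma rowdegN a b (K : 'M[{poly F}]_(a, b)) i : rowdeg (- K) i = rowdeg K i.
Proof. by apply: eq_bigr => j _; rewrite mxE /pdeg size_polyN. Qed.

Lemma rowdegD a b (U V : 'M[{poly F}]_(a, b)) i d :
  (rowdeg U i <= d)%N -> (rowdeg V i <= d)%N -> (rowdeg (U + V) i <= d)%N.
Proof.
move=> /rowdeg_leP leU /rowdeg_leP leV; apply/rowdeg_leP => j; rewrite mxE.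
by apply: leq_trans (size_polyD _ _) _; rewrite geq_max leU leV.
Qed.

Lemma rowdegM a b c (U : 'M[{poly F}]_(a, b)) (V : 'M_(b, c)) i d :
  (forall k, (rowdeg V k <= d)%N) -> (rowdeg (U *m V) i <= rowdeg U i + d)%N.
Proof.
move=> leV; apply/rowdeg_leP => j; rewrite mxE.
apply: leq_trans (size_sum _ _ _) _; apply/bigmax_leqP => k _.
apply: leq_trans (size_polyMleq _ _) _; rewrite -subn1 leq_subLR.
have := size_rowdeg U i k; have /rowdeg_leP/(_ j) := leV k => ? ?.
by rewrite add1n -addnS -addSn leq_add.
Qed.

Lemma rowdeg_cmx a b (K : 'M[F]_(a, b)) i : rowdeg (cmx K) i = 0%N.
Proof.
by apply/eqP; rewrite -leqn0; apply/rowdeg_leP => j; rewrite mxE size_polyC_leq1.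
Qed.

Lemma rowdegM_cmx a b c (U : 'M[{poly F}]_(a, b)) (V : 'M[F]_(b, c)) i :
  (rowdeg (U *m cmx V) i <= rowdeg U i)%N.
Proof.
rewrite -[leqRHS]addn0; apply: rowdegM => k.
by rewrite rowdeg_cmx.
Qed.

Lemma rowdeg_row_mx a b c (U : 'M[{poly F}]_(a, b)) (V : 'M_(a, c)) i :
  rowdeg (row_mx U V) i = maxn (rowdeg U i) (rowdeg V i).
Proof.
rewrite /rowdeg big_split_ord; congr maxn; apply: eq_bigr => j _.
  by rewrite row_mxEl.
by rewrite row_mxEr.
Qed.

(** The highest row degree coefficient matrix: [K] is row reduced exactly when its rows are
    independent. *)
Definition lead_rows a b (K : 'M[{poly F}]_(a, b)) : 'M[F]_(a, b) :=
  \matrix_(i, j) (K i j)`_(rowdeg K i).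

Lemma row_free_row_neq0 (E : fieldType) a b (K : 'M[E]_(a, b)) i :
  row_free K -> row i K != 0.
Proof.
move=> fK; rewrite rowE mulmx_free_eq0 //.
apply/eqP => /matrixP/(_ 0 i); rewrite !mxE !eqxx => /eqP.
by rewrite oner_eq0.
Qed.

(* If [c *m lead_rows K = 0], replacing a row of maximal degree [e] among those
   with [c 0 l != 0] by the combination of the rows with coefficients
   [c 0 l *: 'X^(e - rowdeg K l)] lowers the total degree. *)
Lemma min_basis_lead_rows b (V : 'rV[ratF F]_b -> Prop) a
    (K : 'M[{poly F}]_(a, b)) :
  min_basis_of V K -> row_free (lead_rows K).
Proof.
case=> [[fK VK] minK]; apply: inj_row_free => c cK0.
apply/eqP; apply: contraT => /rV0Pn [i0 ci0].
pose i := [arg max_(k > i0 | c 0 k != 0) rowdeg K k].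
have [ci maxi] : c 0 i != 0 /\
    forall k, c 0 k != 0 -> (rowdeg K k <= rowdeg K i)%N.
  by rewrite /i; case: arg_maxnP.
pose u : 'rV[{poly F}]_a :=
  \row_l (c 0 l *: 'X^(rowdeg K i - rowdeg K l)).
pose K' : 'M_(a, b) := \matrix_k (if k == i then u *m K else row k K).
have rK' k : row k K' = if k == i then u *m K else row k K by rewrite rowK.
have rrow k (U : 'M[{poly F}]_(a, b)) : row k (rmx U) = rmx (row k U).
  by rewrite /rmx map_row.
have KK' : (rmx K' <= rmx K)%MS.
  apply/row_subP => k; rewrite rrow rK'; case: eqP => _.
    by rewrite rmxM submxMl.
  by rewrite -rrow row_sub.
have K'K : (rmx K <= rmx K')%MS.
  have other k : k != i -> (row k (rmx K) <= rmx K')%MS.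
    move=> ki; have <- : row k (rmx K') = row k (rmx K).
      by rewrite !rrow rK' (negPf ki).
    exact: row_sub.
  apply/row_subP => k; have [-> | /other //] := eqVneq k i.
  have : (row i (rmx K') <= rmx K')%MS by rewrite row_sub.
  rewrite rrow rK' eqxx rmxM mulmx_sum_row (bigD1 i) //= => sub.
  (* At [i] the exponent is 0, so this coefficient is the nonzero constant [c 0 i], and row [i] of
     [K] can be solved for. *)
  have ui : rmx u 0 i != 0.
    rewrite !mxE subnn expr0 alg_polyC; apply/eqP => e.
    by move: ci; rewrite -polyC_eq0 -(inj_eq (@pfrac_inj F)) rmorph0 e eqxx.
  rewrite -(scalerK ui (row i _)) scalemx_sub //.
  rewrite -[X in (X <= _)%MS](addrK (\sum_(l | l != i) rmx u 0 l *: row l (rmx K))).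
  rewrite addmx_sub // eqmx_opp; apply: summx_sub => l li.
  by rewrite scalemx_sub // other.
have fK' : row_free (rmx K').
  by rewrite /row_free eqn_leq rank_leq_row -[X in (X <= _)%N](eqP fK) mxrankS.
have bK' : poly_basis_of V K'.
  split=> // v; split=> [/VK/submx_trans->// | vK'].
  by apply/VK; apply: submx_trans KK'.
(* The coefficient at [rowdeg K i] is an entry of [c *m lead_rows K], which is 0, and all higher
   ones vanish. *)
have low j : (size (K' i j) <= rowdeg K i)%N.
  have -> : K' i j = \sum_l (c 0 l *: 'X^(rowdeg K i - rowdeg K l)) * K l j.
    by rewrite mxE eqxx mxE; apply: eq_bigr => l _; rewrite mxE.
  apply/leq_sizeP => t; rewrite leq_eqVlt => /predU1P[<- | lt_t].
    transitivity ((c *m lead_rows K) 0 j); last by rewrite cK0 mxE.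
    rewrite coef_sum mxE; apply: eq_bigr => l _.
    rewrite -scalerAl coefZ coefXnM mxE.
    have [-> | /maxi le_l] := eqVneq (c 0 l) 0; first by rewrite !mul0r.
    by rewrite ltnNge leq_subr /= subKn.
  rewrite coef_sum big1 // => l _; rewrite -scalerAl coefZ coefXnM.
  have [-> | /maxi le_l] := eqVneq (c 0 l) 0; first by rewrite mul0r.
  case: ltnP => _; first by rewrite mulr0.
  rewrite nth_default ?mulr0 //; apply: leq_trans (size_rowdeg K l j) _.
  by rewrite ltn_subRL subnK.
(* The zero polynomial also has [pdeg] 0, so [low] gives a strict drop only in positive degree. In
   degree 0 it would make row [i] of [K'] zero. *)
have di : (0 < rowdeg K i)%N.
  rewrite lt0n; apply/eqP => di0; move: (row_free_row_neq0 i fK') => /eqP; apply.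
  apply/rowP => j; rewrite 2!mxE; move: (low j).
  by rewrite di0 leqn0 size_poly_eq0 => /eqP ->; rewrite rmorph0 mxE.
have := minK _ _ bK'; rewrite /totdeg (bigD1 i) //= [leqRHS](bigD1 i) //=.
rewrite [X in (_ + X <= _)%N](eq_bigr (rowdeg K')) => [|k ki].
  rewrite leq_add2r leqNgt => /negP; case; rewrite -(ltn_predK di) ltnS.
  by apply/rowdeg_leP => j; rewrite (ltn_predK di).
by apply: eq_bigr => j _; rewrite !mxE (negPf ki) mxE.
Qed.

(** If [v] collects the coefficients of row [i] of [U] at its degree, then the coefficients of row
    [i] of the product at [rowdeg U i + d] form [v *m lead_rows K], which is nonzero because [K] is
    row reduced. So the leading terms cannot cancel. *)
Lemma predictable_degree a b c (U : 'M[{poly F}]_(a, b)) (K : 'M_(b, c)) d i :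
  row_free (lead_rows K) -> (forall k, rowdeg K k = d) -> row i U != 0 ->
  rowdeg (U *m K) i = (rowdeg U i + d)%N.
Proof.
move=> fK dK /rV0Pn [k0]; rewrite mxE => Uk0.
apply/eqP; rewrite eqn_leq rowdegM /= => [|k]; last by rewrite dK.
pose v : 'rV[F]_b := \row_k (U i k)`_(rowdeg U i).
have v0 : v != 0.
  have [k maxk] : {k | rowdeg U i = pdeg (U i k)}.
    by apply: (bigop.eq_bigmax (fun k => pdeg (U i k))); apply/card_gt0P; exists k0.
  (* In degree 0 an entry attaining the maximum may be zero; the known nonzero entry [k0], then a
     constant, is used instead. *)
  have [d0 | dpos] := posnP (rowdeg U i).
    apply/rV0Pn; exists k0; rewrite mxE d0.
    have : (size (U i k0) <= 1)%N by rewrite -d0 size_rowdeg.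
    by move/size1_polyC=> e; rewrite e polyC_eq0 in Uk0.
  apply/rV0Pn; exists k; rewrite mxE maxk -/(lead_coef _) lead_coef_eq0.
  by apply/eqP => e; rewrite maxk e /pdeg size_poly0 in dpos.
have /rV0Pn [j] : v *m lead_rows K != 0 by rewrite mulmx_free_eq0.
have -> : (v *m lead_rows K) 0 j = ((U *m K) i j)`_(rowdeg U i + d).
  rewrite !mxE coef_sum; apply: eq_bigr => k _; rewrite !mxE dK coefM.
  (* In the convolution only the product of the two top coefficients survives. *)
  have lt_e : (rowdeg U i < (rowdeg U i + d).+1)%N by rewrite ltnS leq_addr.
  rewrite (bigD1 (Ordinal lt_e)) //= addKn big1 ?addr0 // => l.
  rewrite -val_eqE /= neq_ltn => /orP[lt_l | gt_l].
    rewrite [(K k j)`_ _]nth_default ?mulr0 //.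
    apply: leq_trans (size_rowdeg K k j) _.
    by rewrite dK ltn_subRL ltn_add2r.
  by rewrite nth_default ?mul0r // (leq_trans (size_rowdeg U i k)).
apply: contraR; rewrite -ltnNge => lt_d; apply/eqP; apply: nth_default.
exact: leq_trans (size_rowdeg _ i j) _.
Qed.

(** Predictable degrees read backwards; truncated subtraction lets the bound cover zero rows of [U]
    as well. *)
Lemma rowdeg_factor_le a b c (U : 'M[{poly F}]_(a, b)) (K : 'M_(b, c)) d i :
  row_free (lead_rows K) -> (forall k, rowdeg K k = d) ->
  (rowdeg U i <= rowdeg (U *m K) i - d)%N.
Proof.
move=> fK dK; have [U0 | Un0] := eqVneq (row i U) 0.
  rewrite [rowdeg U i](_ : _ = 0%N) //; apply: big1 => j _.
  by have := congr1 (fun v : 'rV_b => v 0 j) U0; rewrite !mxE => ->;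
    rewrite /pdeg size_poly0.
by rewrite (predictable_degree fK dK) // addnK.
Qed.

End RowDegree.

(** * State-space realizations: observability and transposition *)

Section Realization.
Variable F : fieldType.

Lemma transferE n p m (A : 'M[F]_n) (B : 'M_(n, m)) (C : 'M_(p, n)) :
  transfer A B C = rmx (cmx C) *m invmx (rmx (lampencil A)) *m rmx (cmx B).
Proof. by rewrite rmx_lampencil. Qed.

(** With [P] a row basis of [R], write [C = C1 *m P] and [P *m A = A1 *m P]. Then [(A1, P *m B, C1)]
    realizes the same transfer matrix with state dimension [\rank R], so minimality forces this rank
    to be [n]. *)
Lemma minimal_realization_observable n p m (A : 'M[F]_n) (B : 'M_(n, m))
    (C : 'M_(p, n)) (R : 'M_n) :
  minimal_realization A B C -> (C <= R)%MS -> stablemx R A -> row_full R.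
Proof.
move=> minABC CR RA; set P := row_base R.
have /submxP [C1 defC] : (C <= P)%MS by rewrite eq_row_base.
have /submxP [A1 defA] : (P *m A <= P)%MS.
  by rewrite (eqmxMr A (eq_row_base R)) eq_row_base.
clearbody P; rewrite /row_full eqn_leq rank_leq_col /=.
apply: (minABC _ A1 (P *m B) C1); rewrite !transferE.
have swap : rmx (cmx P) *m rmx (lampencil A) = rmx (lampencil A1) *m rmx (cmx P).
  rewrite -!rmxM /lampencil mulmxBr mulmxBl -!cmxM defA.
  by rewrite mul_mx_scalar mul_scalar_mx.
have U := lampencil_unit A; have U1 := lampencil_unit A1.
have {}swap : invmx (rmx (lampencil A1)) *m rmx (cmx P) =
    rmx (cmx P) *m invmx (rmx (lampencil A)).
  apply: (canRL (mulmxK U)); rewrite -mulmxA swap mulmxA mulVmx ?mul1mx //.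
rewrite defC !cmxM !rmxM !mulmxA; congr (_ *m _).
by rewrite -[LHS]mulmxA swap mulmxA.
Qed.

(* The constant row vectors [v] with [v *m w] polynomial form an [A]-stable
   space containing the rows of [C]; it is enlarged from [0] until it is full. *)
Lemma minimal_realization_polynomial n p m q (A : 'M[F]_n) (B : 'M_(n, m))
    (C : 'M_(p, n)) (w : 'M[ratF F]_(n, q)) (Q1 : 'M_(n, q)) (Q2 : 'M_(p, q)) :
  minimal_realization A B C ->
  rmx (lampencil A) *m w = rmx Q1 -> rmx (cmx C) *m w = rmx Q2 ->
  exists Q, w = rmx Q.
Proof.
move=> minABC Aw Cw.
suff grow k (R : 'M[F]_n) : (n - \rank R <= k)%N ->
    (exists Q, rmx (cmx R) *m w = rmx Q) -> exists Q, w = rmx Q.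
  apply: (grow n 0); first by rewrite leq_subr.
  by exists 0; rewrite /cmx map_mx0 !rmx0 mul0mx.
elim: k R => [|k IHk] R.
  rewrite leqn0 subn_eq0 => full [Q wQ].
  have /row_fullP [R' R'R] : row_full R by rewrite /row_full eqn_leq rank_leq_col.
  by exists (cmx R' *m Q); rewrite rmxM -wQ mulmxA -rmxM -cmxM R'R cmx1 rmx1 mul1mx.
move=> leR [Q wQ]; pose R1 := (R + (C + R *m A)%MS)%MS.
have polyD a b (U : 'M[F]_(a, n)) (V : 'M_(b, n)) QU QV :
    rmx (cmx U) *m w = rmx QU -> rmx (cmx V) *m w = rmx QV ->
    exists Q, rmx (cmx (U + V)%MS) *m w = rmx Q.
  move=> UQ VQ; have /sub_addsmxP [[u v] /= ->] : ((U + V)%MS <= U + V)%MS by [].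
  exists (cmx u *m QU + cmx v *m QV).
  by rewrite cmxD !cmxM !rmxD !rmxM -UQ -VQ mulmxDl !mulmxA.
(* Multiplying $RA = \lambda R - R(\lambda I - A)$ by [w] leaves only polynomial terms. *)
have RAw : rmx (cmx (R *m A)) *m w = rmx ('X%:M *m Q - cmx R *m Q1).
  have -> : cmx (R *m A) = 'X%:M *m cmx R - cmx R *m lampencil A.
    rewrite /lampencil mulmxBr mul_mx_scalar mul_scalar_mx.
    by rewrite opprB addrCA subrr addr0 cmxM.
  by rewrite !rmxD !rmxN !rmxM mulmxDl mulNmx -!mulmxA Aw wQ.
have [Q3 wQ3] := polyD _ _ _ _ _ _ Cw RAw.
have wR1 := polyD _ _ _ _ _ _ wQ wQ3.
have [full | notfull] := boolP (row_full R).
  apply: (IHk R); last by exists Q.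
  by move/eqP: full => ->; rewrite subnn.
apply: (IHk R1) => //.
(* Otherwise [R] would contain the rows of [C] and be [A]-stable, hence full by observability. *)
have lt : (\rank R < \rank R1)%N.
  apply: rank_ltmx; rewrite ltmxE addsmxSl /=; apply: contra notfull.
  rewrite !addsmx_sub => /and3P [_ CR RA].
  exact: minimal_realization_observable minABC CR RA.
move: leR; rewrite !leq_subLR => /leq_trans; apply.
by rewrite addnS -addSn leq_add2r.
Qed.

(** The two signs cancel, so the dual triple realizes the transposed transfer matrix; a smaller
    realization of it would transpose back to a smaller one of the original. *)
Lemma minimal_realization_tr n p m (A : 'M[F]_n) (B : 'M_(n, m)) (C : 'M_(p, n)) :
  minimal_realization A B C -> minimal_realization A^T (- C^T) (- B^T).
Proof.
have trE n' (A' : 'M[F]_n') (B' : 'M_(n', m)) (C' : 'M_(p, n')) :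
    transfer A'^T (- C'^T) (- B'^T) = (transfer A' B' C')^T.
  rewrite !transferE lampencil_tr !cmxN !rmxN mulmxN !mulNmx opprK.
  by rewrite !cmx_tr !rmx_tr !trmx_mul trmx_inv mulmxA.
move=> minABC n' A' B' C' eqG; apply: (minABC _ A'^T (- C'^T) (- B'^T)).
apply: trmx_inj; rewrite -!trE !linearN /= !trmxK !opprK.
by rewrite eqG.
Qed.

End Realization.

(** * Transport of minimal bases along an injective linear map *)

Section Transport.
Variables (F : fieldType) (m b : nat).
Variables (V : 'rV[ratF F]_m -> Prop) (W : 'rV[ratF F]_b -> Prop).
Variables (Phi : 'M[ratF F]_(m, b)) (Psi : 'M[{poly F}]_(b, m)).
Hypothesis PhiK : Phi *m rmx Psi = 1%:M.
Hypothesis W_Phi : forall u, W u <-> exists2 h, V h & u = h *m Phi.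

Lemma poly_basis_image a (K : 'M[{poly F}]_(a, m)) (L : 'M_(a, b)) :
  poly_basis_of V K -> rmx L = rmx K *m Phi -> poly_basis_of W L.
Proof.
move=> [fK VK] LK; split=> [|u].
  have /row_freeP [K' KK'] := fK; apply/row_freeP; exists (rmx Psi *m K').
  by rewrite LK -mulmxA (mulmxA Phi) PhiK mul1mx.
rewrite LK; split=> [/W_Phi [h /VK/submxP [c ->] ->] | /submxP [c ->]].
  by rewrite -mulmxA submxMl.
by apply/W_Phi; exists (c *m rmx K); [apply/VK; rewrite submxMl | rewrite mulmxA].
Qed.

(** [Psi] is polynomial, so pulling back keeps entries polynomial; no basis of [W] escapes the
    correspondence. *)
Lemma poly_basis_preimage a (L : 'M[{poly F}]_(a, b)) :
  poly_basis_of W L ->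
  poly_basis_of V (L *m Psi) /\ rmx L = rmx (L *m Psi) *m Phi.
Proof.
move=> [fL WL].
(* [rmx Psi *m Phi] is a projection fixing the image of [Phi], which contains [W]. *)
have rowsW (u : 'rV_b) : (u <= rmx L)%MS -> u = u *m rmx Psi *m Phi.
  by move=> /WL/W_Phi [h _ ->]; rewrite -!mulmxA (mulmxA Phi) PhiK mul1mx.
have eL : rmx L = rmx (L *m Psi) *m Phi.
  by apply/row_matrixP => i; rewrite rmxM !row_mul [LHS]rowsW ?row_sub.
split=> //; split=> [|h].
  have /row_freeP [L' LL'] := fL; apply/row_freeP; exists (Phi *m L').
  by rewrite mulmxA -eL.
rewrite rmxM; split=> [Vh | /submxP [c ->]].
  have /WL/submxP [c hc] : W (h *m Phi) by apply/W_Phi; exists h.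
  by rewrite -[h]mulmx1 -PhiK mulmxA hc -mulmxA submxMl.
have /W_Phi [h' Vh' ch] : W (c *m rmx L) by apply/WL; rewrite submxMl.
by rewrite mulmxA ch -mulmxA PhiK mulmx1.
Qed.

Lemma poly_basis_size a1 a2 (K1 : 'M[{poly F}]_(a1, m)) (K2 : 'M_(a2, m)) :
  poly_basis_of V K1 -> poly_basis_of V K2 -> a1 = a2.
Proof.
move=> [/eqP f1 V1] [/eqP f2 V2]; rewrite -f1 -f2; apply: eqmx_rank; apply/andP.
by split; apply/row_subP => i; [apply/V2/V1 | apply/V1/V2]; rewrite row_sub.
Qed.

(** All bases of [V] have the same number [a] of rows, so total degrees on the two sides differ by
    the constant [a * d] and are minimized together. *)
Lemma min_indices_shift d s :
  (forall a (K : 'M[{poly F}]_(a, m)), poly_basis_of V K ->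
    exists2 L, rmx L = rmx K *m Phi & forall i, rowdeg L i = (rowdeg K i + d)%N) ->
  min_indices_of V s -> min_indices_of W [seq (e + d)%N | e <- s].
Proof.
move=> lift [a [K [[bK minK] sK]]]; have [L LK dL] := lift _ _ bK.
have totdegE a' (K' : 'M[{poly F}]_(a', m)) (L' : 'M[{poly F}]_(a', b)) :
    (forall i, rowdeg L' i = (rowdeg K' i + d)%N) ->
    totdeg L' = (totdeg K' + a' * d)%N.
  move=> dL'; rewrite /totdeg (eq_bigr _ (fun i _ => dL' i)) big_split /=.
  by rewrite sum_nat_const card_ord.
exists a, L; split; last first.
  rewrite (perm_trans (perm_map _ sK)) // -map_comp.
  by rewrite [X in perm_eq X _](eq_map (g := rowdeg L)) // => i /=; rewrite dL.
split=> [|a' L' bL']; first exact: poly_basis_image bK LK.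
have [bK' L'K'] := poly_basis_preimage bL'.
have [L2 L2K' dL2] := lift _ _ bK'.
(* Any competing basis [L'] is itself the lift of its preimage, so the degree formula applies to
   it. *)
have eL2 : L2 = L' by apply: rmx_inj; rewrite L2K' -L'K'.
rewrite -eL2 (totdegE _ _ _ dL) (totdegE _ _ _ dL2).
by rewrite leq_add ?minK // (poly_basis_size bK bK').
Qed.

End Transport.

(** * The null space of the block pencil *)

(** Block elimination: the third block row determines [y] from [h = k1 *m y], and the first then
    gives [x]. The second, multiplied by [hN2], gives [z], and multiplied by [N2] it becomes the
    null equation for [h]. *)
Lemma block_pencil_null (E : comUnitRingType) (n p m hp hm q : nat)
    (P T S : 'M[E]_n) (B : 'M_(n, m)) (C : 'M_(p, n))
    (M : 'M_(p + hp, m + hm)) (K1 hN1 : 'M_(hm, m + hm))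
    (N1 k1 : 'M_(m, m + hm)) (K2 hN2 : 'M_(hp, p + hp))
    (N2 k2 : 'M_(p, p + hp)) (u : 'M_(n + (m + hm + hp), q)) :
  P \in unitmx -> T \in unitmx -> S \in unitmx ->
  K1 *m N1^T = 0 -> k1 *m N1^T = 1%:M -> hN1^T *m K1 + N1^T *m k1 = 1%:M ->
  K2 *m N2^T = 0 -> k2 *m N2^T = 1%:M ->
  K2 *m hN2^T = 1%:M -> k2 *m hN2^T = 0 ->
  hN2^T *m K2 + N2^T *m k2 = 1%:M ->
  block_mx (T *m P *m S) (row_mx (T *m B *m k1) 0)
           (col_mx (- (k2^T *m C *m S)) 0) (block_mx M K2^T K1 0) *m u = 0 <->
  exists2 h : 'M_(m, q),
    (N2 *m M *m N1^T + C *m invmx P *m B) *m h = 0 &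
    u = col_mx (- (invmx S *m (invmx P *m B)))
               (col_mx N1^T (- (hN2 *m M *m N1^T))) *m h.
Proof.
move=> uP uT uS K1N1 k1N1 U1 K2N2 k2N2 K2hN2 k2hN2 U2.
have trE a b c (X : 'M[E]_(a, b)) (Y : 'M_(c, b)) Z :
    X *m Y^T = Z -> Y *m X^T = Z^T by move=> <-; rewrite trmx_mul trmxK.
have {}K2N2 := trE _ _ _ _ _ _ K2N2; have {}k2N2 := trE _ _ _ _ _ _ k2N2.
have {}K2hN2 := trE _ _ _ _ _ _ K2hN2; have {}k2hN2 := trE _ _ _ _ _ _ k2hN2.
have {}U2 : K2^T *m hN2 + k2^T *m N2 = 1%:M.
  by rewrite -[hN2]trmxK -[N2]trmxK -!trmx_mul -linearD U2 /= trmx1.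
rewrite !trmx0 !trmx1 in K2N2 k2N2 K2hN2 k2hN2.
rewrite -[u]vsubmxK -[dsubmx u]vsubmxK.
set x := usubmx u; set y := usubmx _; set z := dsubmx (dsubmx u).
rewrite mul_block_col mul_row_col mul_col_mx mul_block_col !mul0mx !addr0.
rewrite add_col_mx add0r.
split=> [| [h Gh]]; last rewrite !mul_col_mx => /eq_col_mx [-> /eq_col_mx [-> ->]].
  rewrite -!col_mx0 => /eq_col_mx [e1 /eq_col_mx [e2 e3]].
  rewrite col_mx0 in e2.
  have {e3} y_h : y = N1^T *m (k1 *m y).
    by rewrite -[LHS]mul1mx -U1 mulmxDl -!mulmxA e3 mulmx0 add0r.
  have x_h : x = - (invmx S *m (invmx P *m B)) *m (k1 *m y).
    move/eqP: e1; rewrite addr_eq0 -!mulmxA => /eqP/(canRL (mulKmx uT)).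
    rewrite mulmxN mulKmx // => /(canRL (mulKmx uP))/(canRL (mulKmx uS)).
    by rewrite !mulmxN mulNmx !mulmxA.
  (* The second block row after substituting [x]; the factors [S] and [invmx S] cancel. *)
  have e4 : k2^T *m (C *m invmx P *m B *m (k1 *m y)) + M *m y + K2^T *m z = 0.
    rewrite -[RHS]e2 x_h addrA !mulNmx !mulmxN opprK !mulmxA.
    by rewrite -(mulmxA _ S) mulmxV // mulmx1.
  exists (k1 *m y).
    move/(congr1 (mulmx N2)): e4.
    rewrite !mulmxDr mulmx0 (mulmxA N2 k2^T) k2N2 mul1mx.
    rewrite (mulmxA N2 K2^T) K2N2 mul0mx addr0.
    by rewrite {2}y_h mulmxDl addrC !mulmxA.
  rewrite !mul_col_mx; congr col_mx => //; congr col_mx => //.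
  move/(congr1 (mulmx hN2)): e4.
  rewrite !mulmxDr mulmx0 (mulmxA hN2 k2^T) k2hN2 mul0mx add0r.
  rewrite (mulmxA hN2 K2^T) K2hN2 mul1mx.
  by move/eqP; rewrite addrC addr_eq0 {1}y_h mulNmx !mulmxA => /eqP.
rewrite -!col_mx0; congr col_mx; last congr col_mx;
  last by rewrite mulmxA K1N1 mul0mx.
  rewrite !mulNmx !mulmxN !mulmxA mulmxK // mulmxK //.
  by rewrite -(mulmxA _ k1) k1N1 mulmx1 addNr.
rewrite col_mx0 !mulNmx !mulmxN opprK !mulmxA mulmxK //.
(* Splitting by [U2]: the first summand cancels the contribution of [z], and the second completes
   the null equation, multiplied by [k2^T]. *)
have -> : M *m N1^T *m h =
    K2^T *m hN2 *m M *m N1^T *m h + k2^T *m N2 *m M *m N1^T *m h.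
  by rewrite -!mulmxDl U2 mul1mx.
rewrite [_ + k2^T *m N2 *m M *m _ *m _]addrC addrK -(mulmx0 _ k2^T) -Gh.
by rewrite addrC mulmxDl mulmxDr !mulmxA.
Qed.

(** * Degrees in the linearization and its right minimal indices *)

Lemma rowdeg_lampencil (F : fieldType) n (A : 'M[F]_n) i :
  rowdeg (lampencil A) i = 1%N.
Proof.
apply/eqP; rewrite eqn_leq; apply/andP; split.
  apply/rowdeg_leP => j; rewrite !mxE; apply: leq_trans (size_polyD _ _) _.
  rewrite size_polyN geq_max (leq_trans (size_polyC_leq1 _)) // andbT.
  by case: (i == j); rewrite ?mulr1n ?mulr0n ?size_polyX ?size_poly0.
by have := size_rowdeg (lampencil A) i i; rewrite !mxE eqxx mulr1n size_XsubC.
Qed.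

Lemma lead_rows_lampencil (F : fieldType) n (A : 'M[F]_n) :
  lead_rows (lampencil A) = 1%:M.
Proof.
apply/matrixP => i j; rewrite !mxE rowdeg_lampencil coefB coefC subr0 coefMn coefX.
by rewrite eqxx.
Qed.

Lemma unimodular_blocks (R : pzRingType) h m (K hN : 'M[R]_(h, m + h))
    (N k : 'M_(m, m + h)) :
  col_mx K k *m row_mx hN^T N^T = 1%:M -> row_mx hN^T N^T *m col_mx K k = 1%:M ->
  [/\ K *m N^T = 0, k *m N^T = 1%:M, K *m hN^T = 1%:M, k *m hN^T = 0
    & hN^T *m K + N^T *m k = 1%:M].
Proof.
rewrite mul_col_row scalar_mx_block mul_row_col => /eq_block_mx [? ? ? ?] ?.
by split.
Qed.

(** Minimality of [N1] and [K2] enters as row reducedness. The statement is shaped so that the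
    transposed data, with the indices 1 and 2 exchanged, also fit it. *)
Lemma right_min_indices_sbmb (F : fieldType) (p m : nat) (G : 'M[ratF F]_(p, m))
    (n : nat) (A : 'M[F]_n) (B : 'M_(n, m)) (C : 'M_(p, n))
    (D : 'M[{poly F}]_(p, m)) (hm hp : nat)
    (K1 hN1 : 'M[{poly F}]_(hm, m + hm)) (K2 hN2 : 'M_(hp, p + hp))
    (N1 : 'M[{poly F}]_(m, m + hm)) (N2 : 'M[{poly F}]_(p, p + hp))
    (M : 'M[{poly F}]_(p + hp, m + hm))
    (hK1 : 'M[F]_(m, m + hm)) (hK2 : 'M_(p, p + hp)) (T S : 'M_n)
    (d : nat) (s : seq nat) :
  G = rmx D + transfer A B C -> minimal_realization A B C ->
  row_free (lead_rows N1) -> (forall i, rowdeg N1 i = d) ->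
  row_free (lead_rows K2) -> (forall i, rowdeg K2 i = 1%N) ->
  (forall i j, (size (M i j) <= 2)%N) -> D = N2 *m M *m N1^T ->
  col_mx K1 (cmx hK1) *m row_mx hN1^T N1^T = 1%:M ->
  row_mx hN1^T N1^T *m col_mx K1 (cmx hK1) = 1%:M ->
  col_mx K2 (cmx hK2) *m row_mx hN2^T N2^T = 1%:M ->
  row_mx hN2^T N2^T *m col_mx K2 (cmx hK2) = 1%:M ->
  T \in unitmx -> S \in unitmx ->
  right_min_indices G s ->
  right_min_indices (rmx (sbmb_lin A B C T S hK1 hK2 M K1 K2))
    [seq (e + d)%N | e <- s].
Proof.
move=> HG minABC fN1 dN1 fK2 dK2 dM HD U1 U1' U2 U2' uT uS.
have [K1N1 k1N1 K1hN1 k1hN1 {}U1] := unimodular_blocks U1 U1'.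
have [K2N2 k2N2 K2hN2 k2hN2 {}U2] := unimodular_blocks U2 U2'.
pose P := rmx (lampencil A); have uP : P \in unitmx := lampencil_unit A.
have unitE (X : 'M[F]_n) : X \in unitmx -> rmx (cmx X) \in unitmx.
  move=> uX; apply: rmx_unit; rewrite /cmx det_map_mx polyC_eq0.
  by rewrite -unitfE -unitmxE.
have invE (X : 'M[F]_n) : X \in unitmx -> invmx (rmx (cmx X)) = rmx (cmx (invmx X)).
  move=> uX; rewrite -[LHS]mulmx1; apply: (canLR (mulKmx (unitE _ uX))).
  by rewrite -rmxM -cmxM mulmxV // cmx1 rmx1.
pose PhiT := col_mx (- (rmx (cmx (invmx S)) *m (invmx P *m rmx (cmx B))))
  (col_mx (rmx N1^T) (- rmx (hN2 *m M *m N1^T))).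
pose Psi : 'M[{poly F}]_(n + (m + hm + hp), m) :=
  (row_mx 0 (row_mx (cmx hK1) 0))^T.
have PhiK : PhiT^T *m rmx Psi = 1%:M.
  rewrite rmx_tr -trmx_mul !rmx_row_mx !rmx0 !mul_row_col !mul0mx.
  by rewrite add0r addr0 -rmxM k1N1 rmx1 trmx1.
have nullP u : right_null (rmx (sbmb_lin A B C T S hK1 hK2 M K1 K2)) u <->
    exists2 h, right_null G h & u = h *m PhiT^T.
  have LE : rmx (sbmb_lin A B C T S hK1 hK2 M K1 K2) =
      block_mx (rmx (cmx T) *m P *m rmx (cmx S))
        (row_mx (rmx (cmx T) *m rmx (cmx B) *m rmx (cmx hK1)) 0)
        (col_mx (- ((rmx (cmx hK2))^T *m rmx (cmx C) *m rmx (cmx S))) 0)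
        (block_mx (rmx M) (rmx K2)^T (rmx K1) 0).
    rewrite /sbmb_lin /block_mx !(rmx_col_mx, rmx_row_mx) !rmx0.
    by rewrite rmxN !cmxM !rmxM cmx_tr !rmx_tr.
  have GE : G = rmx N2 *m rmx M *m (rmx N1)^T +
      rmx (cmx C) *m invmx P *m rmx (cmx B).
    by rewrite HG transferE HD; congr (_ + _); rewrite !rmxM rmx_tr.
  rewrite /right_null LE GE.
  have /= := @block_pencil_null _ _ _ _ _ _ _ P (rmx (cmx T)) (rmx (cmx S))
    (rmx (cmx B)) (rmx (cmx C)) (rmx M) (rmx K1) (rmx hN1) (rmx N1) (rmx (cmx hK1))
    (rmx K2) (rmx hN2) (rmx N2) (rmx (cmx hK2)) u^T uP (unitE _ uT) (unitE _ uS).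
  rewrite -!rmx_tr -!rmxM -!rmxD K1N1 k1N1 U1 K2N2 k2N2 K2hN2 k2hN2 U2 !rmx0 !rmx1.
  move=> /(_ erefl erefl erefl erefl erefl erefl erefl erefl).
  rewrite (invE _ uS) => -[toh fromh]; split=> [/toh [h Gh uh] | [h Gh uh]].
    exists h^T; first by rewrite trmxK.
    by apply: trmx_inj; rewrite uh trmx_mul !trmxK.
  by apply: fromh; exists h^T => //; rewrite uh trmx_mul trmxK.
apply: (min_indices_shift PhiK nullP) => a K [fK nullK].
have GK : G *m (rmx K)^T = 0.
  apply: trmx_inj; rewrite trmx_mul trmxK trmx0; apply/row_matrixP => i.
  have : right_null G (row i (rmx K)) by apply/nullK; rewrite row_sub.
  rewrite /right_null row_mul row0 => /(congr1 trmx).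
  by rewrite trmx_mul trmxK trmx0.
pose w := invmx P *m (rmx (cmx B) *m (rmx K)^T).
have Pw : P *m w = rmx (cmx B *m K^T) by rewrite mulKVmx // rmxM rmx_tr.
(* From [G *m (rmx K)^T = 0]: the strictly proper part must cancel the polynomial part on [K]. *)
have Cw : rmx (cmx C) *m w = rmx (- (D *m K^T)).
  move/eqP: GK; rewrite HG transferE mulmxDl addrC addr_eq0 => /eqP.
  by rewrite rmxN rmxM rmx_tr => <-; rewrite /w !mulmxA.
have [Q wQ] := minimal_realization_polynomial minABC Pw Cw.
have PQ : lampencil A *m Q = cmx B *m K^T.
  by apply: rmx_inj; rewrite rmxM -wQ Pw.
have CQ : cmx C *m Q = - (D *m K^T).
  by apply: rmx_inj; rewrite rmxM -wQ Cw.
pose Y := K *m N1; pose Z := - (Y *m M^T *m hN2^T).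
exists (row_mx (Q^T *m cmx (- invmx S)^T) (row_mx Y Z)).
  apply: trmx_inj; rewrite trmx_mul trmxK -!rmx_tr.
  rewrite !tr_row_mx !rmx_col_mx !mul_col_mx; congr col_mx.
    rewrite trmx_mul -cmx_tr !trmxK cmxN mulNmx rmxN rmxM.
    by rewrite -wQ mulNmx /w -rmx_tr !mulmxA.
  congr col_mx; first by rewrite trmx_mul rmxM.
  rewrite /Z /Y linearN /= !trmx_mul !trmxK rmxN mulNmx !rmxM.
  by rewrite !mulmxA.
move=> i.
have dY : rowdeg Y i = (rowdeg K i + d)%N.
  apply: predictable_degree => //.
  have := row_free_row_neq0 i fK; apply: contraNneq => Ki0.
  by rewrite /rmx -map_row Ki0 map_mx0.
(* [Q^T *m lampencil A^T] equals [K *m (cmx B)^T], of row degree at most that of [K], and the right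
   factor is row reduced. *)
have dQ : (rowdeg Q^T i <= rowdeg K i)%N.
  have fA : row_free (lead_rows (lampencil A^T)).
    by rewrite lead_rows_lampencil row_free_unit unitmx1.
  apply: leq_trans (rowdeg_factor_le Q^T i fA (rowdeg_lampencil A^T)) _.
  rewrite lampencil_tr -trmx_mul PQ trmx_mul trmxK -cmx_tr.
  by apply: leq_trans (leq_subr _ _) (rowdegM_cmx _ _ _).
(* A direct bound on [Z] would involve the degree of [hN2]. Multiplying by [K2] and using [U2]
   removes [hN2]; the remaining term in [N2] is expressed by [Q] through [CQ]. *)
have ZK2 : Z *m K2 = - (Y *m M^T) - Q^T *m cmx (C^T *m hK2).
  have CQt : Q^T *m (cmx C)^T = - (Y *m M^T *m N2^T).
    rewrite -trmx_mul CQ linearN /= HD !trmx_mul !trmxK /Y.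
    by rewrite !mulmxA.
  rewrite cmxM cmx_tr mulmxA CQt /Z !mulNmx opprK.
  rewrite -[X in - X + _]mulmx1 -U2 mulmxDr opprD !mulmxA.
  by rewrite -addrA addNr addr0.
(* The degree 1 added by the pencil [M] is taken back by the row degree 1 of [K2]. *)
have dZ : (rowdeg Z i <= rowdeg Y i)%N.
  apply: leq_trans (rowdeg_factor_le Z i fK2 dK2) _.
  rewrite ZK2 leq_subLR [leqRHS]addnC; apply: rowdegD; rewrite rowdegN.
    by apply: rowdegM => k; apply/rowdeg_leP => j; rewrite mxE.
  apply: leq_trans (rowdegM_cmx _ _ _) _; apply: leq_trans dQ _.
  by rewrite dY -addnA leq_addr.
rewrite !rowdeg_row_mx (maxn_idPl dZ) dY; apply/maxn_idPr.
apply: leq_trans (rowdegM_cmx _ _ _) _.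
by apply: leq_trans dQ _; rewrite leq_addr.
Qed.

(** * Left minimal indices by transposition *)

Lemma eq_min_indices_of (F : fieldType) b (V W : 'rV[ratF F]_b -> Prop) s :
  (forall u, V u <-> W u) -> min_indices_of V s -> min_indices_of W s.
Proof.
move=> VW; have eqb a (K : 'M[{poly F}]_(a, b)) : poly_basis_of V K <-> poly_basis_of W K.
  split=> -[fK VK]; split=> // u; last exact: iff_trans (VW u) (VK u).
  exact: iff_trans (iff_sym (VW u)) (VK u).
move=> [a [K [[/eqb bK minK] sK]]]; exists a, K; split=> //; split=> // a' K' /eqb.
exact: minK.
Qed.

Lemma left_null_tr (F : fieldType) p m (G : 'M[ratF F]_(p, m)) u :
  left_null G u <-> right_null G^T u.
Proof.
rewrite /left_null /right_null -trmx_mul; split=> [-> | /(congr1 trmx)].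
  by rewrite trmx0.
by rewrite trmxK trmx0.
Qed.

(** The pencil has a minus sign only at the block of [C]. Transposition moves that block to the
    place of [B], so both matrices change sign. *)
Lemma sbmb_lin_tr (F : fieldType) (n p m hp hm : nat) (A : 'M[F]_n)
    (B : 'M_(n, m)) (C : 'M_(p, n)) (T S : 'M_n) (hK1 : 'M_(m, m + hm))
    (hK2 : 'M_(p, p + hp)) (M : 'M[{poly F}]_(p + hp, m + hm))
    (K1 : 'M[{poly F}]_(hm, m + hm)) (K2 : 'M[{poly F}]_(hp, p + hp)) :
  (sbmb_lin A B C T S hK1 hK2 M K1 K2)^T =
  sbmb_lin A^T (- C^T) (- B^T) S^T T^T hK2 hK1 M^T K2 K1.
Proof.
rewrite /sbmb_lin !tr_block_mx tr_row_mx tr_col_mx !trmx0 !trmxK lampencil_tr.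
congr block_mx.
- by rewrite !trmx_mul -!cmx_tr mulmxA.
- by rewrite linearN /= -cmx_tr !trmx_mul trmxK mulmxN mulNmx cmxN !mulmxA.
- by rewrite -cmx_tr !trmx_mul mulmxN mulNmx cmxN opprK !mulmxA.
Qed.

Theorem theorem6p7
  (F : fieldType) (p m : nat) (G : 'M[ratF F]_(p, m))
  (n : nat) (A : 'M[F]_n) (B : 'M[F]_(n, m)) (C : 'M[F]_(p, n))
  (D : 'M[{poly F}]_(p, m))
  (hm hp : nat)
  (K1 : 'M[{poly F}]_(hm, m + hm)) (K2 : 'M[{poly F}]_(hp, p + hp))
  (N1 : 'M[{poly F}]_(m, m + hm)) (N2 : 'M[{poly F}]_(p, p + hp))
  (M : 'M[{poly F}]_(p + hp, m + hm))
  (hK1 : 'M[F]_(m, m + hm)) (hK2 : 'M[F]_(p, p + hp))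
  (hN1 : 'M[{poly F}]_(hm, m + hm)) (hN2 : 'M[{poly F}]_(hp, p + hp))
  (T S : 'M[F]_n)
  (* G = D + C (lambda I - A)^{-1} B, D polynomial, deg D > 1, minimal realization *)
  (HG : G = rmx D + transfer A B C)
  (HdegD : (1 < mxdeg D)%N)
  (Hreal : minimal_realization A B C)
  (* K1, K2 minimal bases with all row degrees 1 *)
  (HK1 : minimal_basis K1) (HK1deg : forall i, rowdeg K1 i = 1%N)
  (HK2 : minimal_basis K2) (HK2deg : forall i, rowdeg K2 i = 1%N)
  (* N1, N2 minimal bases dual to K1, K2, with all row degrees equal *)
  (HN1 : dual_minimal_bases K1 N1) (HN1deg : forall i j, rowdeg N1 i = rowdeg N1 j)
  (HN2 : dual_minimal_bases K2 N2) (HN2deg : forall i j, rowdeg N2 i = rowdeg N2 j)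
  (* M is a pencil, D = N2 M N1^T, deg D = deg N1 + deg N2 + 1 *)
  (HM : forall i j, (size (M i j) <= 2)%N)
  (HD : D = N2 *m M *m N1^T)
  (HdegD' : mxdeg D = (mxdeg N1 + mxdeg N2 + 1)%N)
  (* [K_i; hK_i] unimodular with inverse [hN_i^T  N_i^T] *)
  (HU1 : col_mx K1 (cmx hK1) *m row_mx hN1^T N1^T = 1%:M)
  (HU1' : row_mx hN1^T N1^T *m col_mx K1 (cmx hK1) = 1%:M)
  (HU2 : col_mx K2 (cmx hK2) *m row_mx hN2^T N2^T = 1%:M)
  (HU2' : row_mx hN2^T N2^T *m col_mx K2 (cmx hK2) = 1%:M)
  (* T, S nonsingular *)
  (HT : T \in unitmx) (HS : S \in unitmx) :
  let L := rmx (sbmb_lin A B C T S hK1 hK2 M K1 K2) in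
  (forall eps : seq nat, sorted leq eps -> right_min_indices G eps ->
     right_min_indices L [seq (e + mxdeg N1)%N | e <- eps]) /\
  (forall eta : seq nat, sorted leq eta -> left_min_indices G eta ->
     left_min_indices L [seq (e + mxdeg N2)%N | e <- eta]).

Proof.
have leadK a b (K : 'M[{poly F}]_(a, b)) : minimal_basis K -> row_free (lead_rows K).
  by case=> _ /min_basis_lead_rows.
have constdeg a b (K : 'M[{poly F}]_(a, b)) :
    (forall i j, rowdeg K i = rowdeg K j) -> forall i, rowdeg K i = mxdeg K.
  move=> eqK i; apply/eqP; rewrite eqn_leq; apply/andP; split.
    exact: (leq_bigmax (F := rowdeg K)).
  by apply/bigmax_leqP => j _; rewrite (eqK j i).
have [_ minN1 _ _] := HN1; have [_ minN2 _ _] := HN2.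
move=> L; split=> [eps _ | eta _].
  apply: (@right_min_indices_sbmb F p m G n A B C D hm hp K1 hN1 K2 hN2 N1 N2) => //.
  - exact: leadK.
  - exact: constdeg.
  - exact: leadK.
move=> /(eq_min_indices_of (left_null_tr G)) etaG.
apply: (eq_min_indices_of (fun u => iff_sym (left_null_tr L u))).
rewrite /L -rmx_tr sbmb_lin_tr.
(* Transposition exchanges [K1] with [K2], [N1] with [N2] and [T] with [S], so the shift is now the
   degree of [N2]. *)
apply: (@right_min_indices_sbmb F m p G^T n A^T (- C^T) (- B^T) D^T hp hm
  K2 hN2 K1 hN1 N2 N1) => //.
- rewrite HG linearD /= -rmx_tr; congr (_ + _); rewrite !transferE.
  rewrite lampencil_tr !cmxN !rmxN !mulNmx mulmxN opprK.
  by rewrite !cmx_tr !rmx_tr !trmx_mul trmx_inv mulmxA.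
- exact: minimal_realization_tr.
- exact: leadK.
- exact: constdeg.
- exact: leadK.
- by move=> i j; rewrite mxE.
- by rewrite HD !trmx_mul trmxK mulmxA.
- by rewrite unitmx_tr.
- by rewrite unitmx_tr.
Qed.
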